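(* There exists an absolute constant $C>0$ with the following property. For all integers $d\ge 1$ and $n\ge 1$ and every nonzero polynomial $P\in\mathbb R[x_1,\ldots,x_d]$ of degree $n$, if the pair of points \[ (p,q)\in S^{2d-1}\subset\mathbb R^d\times\mathbb R^d \] maximizes the absolute value of the product $P(x)P(y)$ over $(x,y)\in S^{2d-1}$, then at least one of $p\in B^d$ and $q\in B^d$ is at distance at least $\frac{C}{n}$ from the zero set of the polynomial $P$.
   Context: $S^{2d-1}=\{(x,y)\in\mathbb R^d\times\mathbb R^d : |x|^2+|y|^2=1\}$, where $|\cdot|$ is the Euclidean norm, and $B^d=\{x\in\mathbb R^d : |x|\le 1\}$ is the closed unit ball. The zero set of $P$ is $\{x\in\mathbb R^d : P(x)=0\}$. Distance is Euclidean; ''a point is at distance at least $r$ from a set $Z$'' means that every point of $Z$ is at distance at least $r$ from it (vacuously true if $Z$ is empty). *)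

(* Defs.v *)
From mathcomp Require Import all_boot all_order all_algebra.
From mathcomp Require Import classical_sets reals.
(* The notations of mpoly clash with those of MathComp-Analysis. *)
From mathcomp Require Import -(notations) mpoly.

Set Implicit Arguments.
Unset Strict Implicit.
Unset Printing Implicit Defensive.

Import Order.TTheory GRing.Theory Num.Theory.

Local Open Scope classical_set_scope.
Local Open Scope ring_scope.

(* The norm `|x| that MathComp-Analysis puts on 'rV[R]_d is the max norm. *)
Definition enorm (R : realType) (d : nat) (x : 'rV[R]_d) : R :=
  Num.sqrt (\sum_(i < d) x ord0 i ^+ 2).

Definition unit_ball (R : realType) (d : nat) : set 'rV[R]_d :=
  [set x | enorm x <= 1].

(* S^(2d-1), with R^(2d) written as R^d x R^d. *)
Definition pair_sphere (R : realType) (d : nat) : set ('rV[R]_d * 'rV[R]_d) :=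
  [set z | enorm z.1 ^+ 2 + enorm z.2 ^+ 2 = 1].

Definition peval (R : realType) (d : nat) (P : mpoly d R)
  (x : 'rV[R]_d) : R := meval (x ord0) P.

Definition zero_set (R : realType) (d : nat) (P : mpoly d R) :
  set 'rV[R]_d := [set x | peval P x = 0].

(* Vacuously true for empty Z, whereas an infimum in R of the empty set of
   distances would be 0. *)
Definition dist_at_least (R : realType) (d : nat) (r : R) (x : 'rV[R]_d)
  (Z : set 'rV[R]_d) : Prop := forall z, Z z -> r <= enorm (x - z).

Definition maximizes (R : realType) (T : Type) (f : T -> R) (A : set T)
  (a : T) : Prop := A a /\ forall b, A b -> f b <= f a.

(* Main.v *)
Require Import Defs.
From mathcomp Require Import all_boot all_order all_algebra.
From mathcomp Require Import classical_sets reals.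
From mathcomp Require Import -(notations) mpoly.
From mathcomp Require Import zify ring lra.

Set Implicit Arguments.
Unset Strict Implicit.
Unset Printing Implicit Defensive.

Import Order.TTheory GRing.Theory Num.Theory.

Local Open Scope classical_set_scope.
Local Open Scope ring_scope.

(** A polynomial whose modulus on a sphere is largest at some point cannot
    fall to zero too quickly along a great circle through that point.  This is
    applied on S^(2d-1) to F(x, y) = P(x) P(y), of degree at most 2n, whose
    modulus is maximal at (p, q).

    On a great circle parametrized by (a, b), a^2 + b^2 = 1, with (1, 0) the
    point (p, q), a polynomial of degree at most m has the form A(a) + b B(a)
    with deg A <= m ([circle_poly]).  The even part A is bounded on [-1, 1] by
    |A(1)|, and at a zero of F it is at most |A(1)| / 2.  A weak form of
    Markov's inequality at an endpoint, |A(1) - A(x)| <= 4 m^2 (1 - x) max |A|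
    ([markov_endpoint]), then gives 1 - a >= 1 / (8 m^2): every zero of F on
    the sphere is at distance at least 1 / (4 n) from (p, q)
    ([maximizer_zero_far]).

    The endpoint inequality follows from Lagrange interpolation of the
    quotient (A(1) - A(x)) / (1 - x) at the nodes 1 - 2 k^2 / m^2,
    1 <= k <= m.  These squares imitate the extrema of the Chebyshev
    polynomial near the endpoint, where cos t is about 1 - t^2 / 2; the
    basis polynomials are bounded by 2 near the endpoint, and the sum of the
    bounds converges because the sum of 1 / k^2 does.

    Finally let p be the shorter of the two points, so that |q|^2 >= 1/2, and
    let z be a zero of P close to p.  Rescaling q to a vector y with
    |z|^2 + |y|^2 = 1 moves it by at most a constant times |p - z|
    ([sphere_completion]).  Then (z, y) is a zero of F on the sphere, so
    |p - z| cannot be small compared with 1 / n. *)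

(** * Interpolation at squares *)

Lemma rising_fact (k i : nat) :
  (k`! * \prod_(1 <= j < i.+1) (k + j) = (k + i)`!)%N.
Proof.
elim: i => [|i IH]; first by rewrite big_nil muln1 addn0.
by rewrite big_nat_recr //= mulnA IH addnS factS mulnC.
Qed.

Lemma fact_sqr_le (i k : nat) : ((i + k)`! ^ 2 <= i`! * (k + k + i)`!)%N.
Proof.
have -> : (k + k + i = i + k + k)%N by lia.
rewrite -[X in (_ <= _ * X)%N]rising_fact -mulnn -{1}rising_fact -!mulnA leq_mul2l.
rewrite mulnC leq_mul2l; apply/orP; right; apply/orP; right.
by apply: leq_prod => j _; rewrite leq_add2r leq_addr.
Qed.

Lemma prod_diff_sqr_lt (k : nat) :
  ((2 * k.+1)`! * \prod_(1 <= j < k.+1) j ^ 2 =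
   2 * k.+1`! ^ 2 * \prod_(1 <= j < k.+1) (k.+1 ^ 2 - j ^ 2))%N.
Proof.
have -> : (\prod_(1 <= j < k.+1) (k.+1 ^ 2 - j ^ 2) =
           (\prod_(1 <= j < k.+1) (k.+1 - j)) *
           \prod_(1 <= j < k.+1) (k.+1 + j))%N.
  by rewrite -big_split; apply: eq_bigr => j _; rewrite subn_sqr.
have -> : (\prod_(1 <= j < k.+1) (k.+1 - j) = k`!)%N.
  rewrite fact_prod big_nat_rev /=; apply: eq_big_nat => j /andP[j1 jk].
  by lia.
rewrite -(big_morph (fun x : nat => (x ^ 2)%N) (fun x y => expnMn x y 2) (exp1n 2)).
rewrite -fact_prod.
have -> : (2 * k.+1 = (k.+1 + k).+1)%N by lia.
rewrite factS -rising_fact factS.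
set p := (\prod_(_ <= _ < _) _)%N; set f := (k`!)%N.
nia.
Qed.

Lemma prod_nat_recr_cond (R : pzSemiRingType) (P : pred nat) (f : nat -> R)
    (n : nat) :
  \prod_(1 <= j < n.+2 | P j) f j =
  (\prod_(1 <= j < n.+1 | P j) f j) * (if P n.+1 then f n.+1 else 1).
Proof. by rewrite big_mkcond big_nat_recr //= -big_mkcond. Qed.

(** This evaluates the modulus at 0 of the Lagrange basis polynomial of the
    nodes 1^2, ..., m^2 at k^2, where m = k + i: it is
    2 m!^2 / ((m - k)! (m + k)!).  Denominators are cleared so that the
    induction on i only multiplies both sides by the factor of the new node
    k + i + 1, since (k + i + 1)^2 - k^2 = (i + 1) (2 k + i + 1). *)
Lemma prod_node_gap (F : numFieldType) (k i : nat) : (0 < k)%N ->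
  i`!%:R * (k + k + i)`!%:R * \prod_(1 <= j < (k + i).+1 | j != k) (j%:R ^+ 2)
  = 2 * (k + i)`!%:R ^+ 2 *
    \prod_(1 <= j < (k + i).+1 | j != k) `|k%:R ^+ 2 - j%:R ^+ 2| :> F.
Proof.
case: k => // k _; elim: i => [|i IH].
  rewrite !addn0 fact0 mul1r !prod_nat_recr_cond eqxx /= !mulr1.
  have full (f : nat -> F) :
      \prod_(1 <= j < k.+1 | j != k.+1) f j = \prod_(1 <= j < k.+1) f j.
    rewrite big_nat_cond [RHS]big_nat_cond; apply: eq_bigl => j.
    by case: (ltngtP j k.+1); rewrite ?andbF.
  rewrite !full.
  have := congr1 (fun x : nat => x%:R : F) (prod_diff_sqr_lt k).
  have sqrs : (\prod_(1 <= j < k.+1) j ^ 2)%:R =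
      \prod_(1 <= j < k.+1) j%:R ^+ 2 :> F.
    by rewrite natr_prod; apply: eq_bigr => j _; rewrite natrX.
  rewrite natrM sqrs natrM natrM natrX natr_prod mul2n -addnn.
  move=> ->; congr (_ * _); apply: eq_big_nat => j /andP[_ jk].
  rewrite natrB ?leq_exp2r ?(ltnW jk) // !natrX ger0_norm //.
  by rewrite subr_ge0 -!natrX ler_nat leq_exp2r // ltnW.
rewrite !(addnS _ i) !(prod_nat_recr_cond _ _ (k.+1 + i)).
have -> : ((k.+1 + i).+1 != k.+1)%N = true by apply/eqP; lia.
rewrite (factS i) (factS (k.+1 + i)) (factS (k.+1 + k.+1 + i)).
rewrite (natrM _ i.+1) (natrM _ (k.+1 + i).+1) (natrM _ (k.+1 + k.+1 + i).+1).
move: IH; set A := i`!%:R; set B := _`!%:R; set D := _`!%:R.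
set p1 := bigop _ _ _; set p2 := bigop _ _ _ => IH.
have -> : `|k.+1%:R ^+ 2 - (k.+1 + i).+1%:R ^+ 2| =
   i.+1%:R * (k.+1 + k.+1 + i).+1%:R :> F.
  rewrite -normrN opprB ger0_norm ?subr_ge0 -?natrX ?ler_nat ?leq_exp2r //;
    last by lia.
  have le : (k.+1 ^ 2 <= (k.+1 + i).+1 ^ 2)%N by rewrite leq_exp2r //; lia.
  rewrite -natrB // subn_sqr -natrM.
  have -> : ((k.+1 + i).+1 - k.+1 = i.+1)%N by lia.
  by congr ((_ * _)%N%:R); rewrite addSn addnAC.
transitivity (i.+1%:R * (k.+1 + k.+1 + i).+1%:R * (k.+1 + i).+1%:R ^+ 2 *
   (A * B * p1)); first by ring.
by rewrite IH; ring.
Qed.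

(** In the closed form above, m!^2 <= (m - k)! (m + k)!, which leaves the
    factor 2. *)
Lemma prod_node_gap_ge (F : numFieldType) (m k : nat) : (0 < k <= m)%N ->
  \prod_(1 <= j < m.+1 | j != k) (j%:R ^+ 2) <=
  2 * \prod_(1 <= j < m.+1 | j != k) `|k%:R ^+ 2 - j%:R ^+ 2| :> F.
Proof.
move=> /andP[k0 km]; have [i ->] : exists i, m = (k + i)%N by exists (m - k)%N; lia.
have e := prod_node_gap F i k0.
set p1 := bigop _ _ _ in e *; set p2 := bigop _ _ _ in e *.
have p2_ge0 : 0 <= p2 by apply: prodr_ge0.
have le : (i + k)`!%:R ^+ 2 <= i`!%:R * (k + k + i)`!%:R :> F.
  by rewrite -natrX -natrM ler_nat fact_sqr_le.
have pos : 0 < i`!%:R * (k + k + i)`!%:R :> F by rewrite mulr_gt0 ?ltr0n ?fact_gt0.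
rewrite -(ler_pM2l pos) e -[leLHS]mulrA [leRHS]mulrCA ler_pM2l ?ltr0n //.
by rewrite ler_wpM2r // addnC.
Qed.

(** The nodes are the squares 1, 4, 9, ..., indexed from 0 as [lagrange]
    requires. *)
Definition node (F : pzRingType) (i : nat) : F := i.+1%:R ^+ 2.

Lemma node_inj (F : numFieldType) : injective (node F).
Proof.
move=> i j /eqP; rewrite /node -!natrX eqr_nat eqn_exp2r // => /eqP.
exact: succn_inj.
Qed.

Lemma node_ge1 (F : numFieldType) (i : nat) : 1 <= node F i.
Proof. by rewrite /node -natrX ler1n expn_gt0. Qed.

Lemma prod_ord_succ (F : pzSemiRingType) (m : nat) (i : 'I_m) (f : nat -> F) :
  \prod_(1 <= j < m.+1 | j != i.+1) f j = \prod_(j < m | j != i) f j.+1.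
Proof. by rewrite big_add1 big_mkord. Qed.

(** For y in [0, 1] every factor |y - j^2| is at most j^2, so the value at y
    is dominated by the modulus at 0. *)
Lemma lagrange_node_le (F : realFieldType) (m : nat) (i : 'I_m) (y : F) :
  0 <= y <= 1 -> `|(tnth (lagrange m (node F)) i : {poly F}).[y]| <= 2.
Proof.
move=> /andP[y0 y1]; have m0 : (0 < m)%N by case: (m) i => [[]|].
rewrite lagrangeE // ?hornerM ?hornerC ?horner_prod; last exact: node_inj.
have gap : 0 < \prod_(j < m | j != i) `|node F i - node F j|.
  apply: prodr_gt0 => j ji; rewrite normr_gt0 subr_eq0.
  by apply: contra ji => /eqP/node_inj/val_inj ->.
rewrite normrM normfV mulrC !normr_prod.
under [X in _ / X <= _]eq_bigr do rewrite hornerXsubC.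
rewrite ler_pdivrMr //.
have := @prod_node_gap_ge F m i.+1; rewrite !prod_ord_succ ltn_ord => /(_ isT).
apply: le_trans; apply: ler_prod => j _; rewrite normr_ge0 hornerXsubC.
have := node_ge1 F j; rewrite /node => n1.
by rewrite ler_norml; apply/andP; split; lra.
Qed.

(** Telescoping: 1 / (t + 1)^2 <= 1 / t - 1 / (t + 1). *)
Lemma sum_inv_node_le (F : realFieldType) (m : nat) :
  \sum_(i < m) (node F i)^-1 <= 2.
Proof.
case: m => [|m]; first by rewrite big_ord0.
suff h : \sum_(i < m.+1) (node F i)^-1 <= 2 - m.+1%:R^-1.
  by apply: le_trans h _; rewrite gerBl invr_ge0 ler0n.
elim: m => [|m IH]; first by rewrite big_ord1 /node expr1n invr1; lra.
rewrite big_ord_recr /=; apply: le_trans (lerD IH (lexx _)) _.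
rewrite /node -[m.+2]addn1 natrD; set t : F := m.+1%:R.
have t0 : 0 < t by rewrite ltr0n.
have : (t + 1) ^- 2 <= (t * (t + 1))^-1.
  by rewrite lef_pV2 ?posrE ?exprn_gt0 ?mulr_gt0 // ; nra.
have -> : (t * (t + 1))^-1 = t^-1 - (t + 1)^-1 by field; rewrite !gt_eqF //; lra.
by move: t^-1 (t + 1)^-1 ((t + 1) ^- 2) => a b c ?; lra.
Qed.

Lemma interpolation_bound (F : realFieldType) (m : nat) (r : {poly F}) (M y : F) :
  (0 < m)%N -> (size r <= m)%N ->
  (forall i, (i < m)%N -> `|r.[node F i]| <= M / node F i) ->
  0 <= y <= 1 -> `|r.[y]| <= 4 * M.
Proof.
move=> m0 sr bnd y01.
have M0 : 0 <= M.
  have := le_trans (normr_ge0 _) (bnd 0%N m0); rewrite pmulr_lge0 //.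
  by rewrite invr_gt0 (lt_le_trans ltr01) ?node_ge1.
rewrite [r](lagrange_gen m0 (@node_inj F) sr) horner_sum.
apply: le_trans (ler_norm_sum _ _ _) _.
apply: (@le_trans _ _ (\sum_(i < m) 2 * M * (node F i)^-1)).
  apply: ler_sum => i _; rewrite hornerM hornerC normrM -mulrA mulrC.
  by apply: ler_pM => //; [apply: lagrange_node_le | apply: bnd].
rewrite -mulr_sumr; have := sum_inv_node_le F m; set s := bigop _ _ _ => s2.
nra.
Qed.

(** The substitution y = (1 - x) m^2 / 2 sends x = 1 to 0 and the interval
    [-1, 1] to [0, m^2], which contains the nodes.  Write h(y) for g(x).  The
    quotient r of h(0) - h(y) by y has degree less than m and satisfies
    |r(k^2)| <= 2 M / k^2, so it is at most 8 M on [0, 1].  When y > 1 the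
    trivial bound 2 M suffices. *)
Lemma markov_endpoint (F : realFieldType) (m : nat) (g : {poly F}) (M x : F) :
  (size g <= m.+1)%N -> (forall t, -1 <= t <= 1 -> `|g.[t]| <= M) ->
  -1 <= x <= 1 -> `|g.[1] - g.[x]| <= 4 * m%:R ^+ 2 * (1 - x) * M.
Proof.
move=> sg bnd /andP[x1 x2].
have M0 : 0 <= M by apply: le_trans (normr_ge0 _) (bnd 1 _); lra.
case: m sg => [|m'] sg.
  by rewrite (size1_polyC sg) !hornerC subrr normr0 expr0n /= mulr0 !mul0r.
set m := m'.+1 in sg *; set c : F := m%:R.
have c0 : 0 < c by rewrite ltr0n.
pose y := (1 - x) * c ^+ 2 / 2.
have y0 : 0 <= y by rewrite /y; nra.
have -> : 4 * c ^+ 2 * (1 - x) * M = y * (8 * M) by rewrite /y; field.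
have [y1|y1] := leP y 1; last first.
  have g1 : `|g.[1]| <= M by apply: bnd; lra.
  have gx : `|g.[x]| <= M by apply: bnd; lra.
  by apply: le_trans (ler_normB _ _) _; nra.
pose h := g \Po (1%:P - (2 / c ^+ 2) *: 'X).
have hE t : h.[t] = g.[1 - 2 / c ^+ 2 * t].
  by rewrite horner_comp hornerD hornerN hornerZ hornerX hornerC.
have h0 : h.[0] = g.[1] by rewrite hE mulr0 subr0.
have hy : h.[y] = g.[x].
  by rewrite hE /y; congr _.[_]; field; rewrite gt_eqF.
have sh : (size h <= m.+1)%N.
  apply: leq_trans (size_comp_poly_leq _ _) _.
  have s2 : (size (1%:P - (2 / c ^+ 2) *: 'X : {poly F})).-1 = 1%N.
    have k0 : 2 / c ^+ 2 != 0 by rewrite mulf_neq0 ?invr_eq0 ?expf_neq0 ?gt_eqF.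
    have sX : size (- ((2 / c ^+ 2) *: 'X) : {poly F}) = 2%N.
      by rewrite size_polyN size_scale ?size_polyX.
    by rewrite addrC size_polyDl sX // size_polyC oner_eq0.
  by rewrite s2 muln1; case: (size g) sg.
have /factor_theorem[r rE] : root (h.[0]%:P - h) 0.
  by rewrite rootE hornerD hornerN hornerC subrr.
rewrite subr0 in rE.
have rt t : h.[0] - h.[t] = r.[t] * t.
  have := congr1 (fun p => p.[t]) rE.
  by rewrite hornerM hornerX hornerD hornerN hornerC.
have sr : (size r <= m)%N.
  have [->|rn0] := eqVneq r 0; first by rewrite size_poly0.
  rewrite -ltnS -size_mulX // -rE; apply: leq_trans (size_polyD _ _) _.
  by rewrite geq_max size_polyN sh (leq_trans (size_polyC_leq1 _)).
rewrite -h0 -hy rt normrM (ger0_norm y0) mulrC ler_wpM2l //.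
have -> : 8 * M = 4 * (2 * M) by ring.
apply: (@interpolation_bound _ m); rewrite ?y0 //= => i im.
have n0 : 0 < node F i by rewrite (lt_le_trans ltr01) ?node_ge1.
rewrite ler_pdivlMr // -{2}(gtr0_norm n0) -normrM -rt.
apply: le_trans (ler_normB _ _) _.
have : `|h.[0]| <= M by rewrite h0; apply: bnd; lra.
suff : `|h.[node F i]| <= M by lra.
rewrite hE; apply: bnd.
have nc : node F i <= c ^+ 2 by rewrite /node /c -!natrX ler_nat leq_exp2r.
have : 0 <= node F i / c ^+ 2 <= 1.
  by rewrite divr_ge0 ?(ltW n0) ?sqr_ge0 //= ler_pdivrMr ?exprn_gt0 // mul1r.
by rewrite -mulrA [_^-1 * _]mulrC; set t := _ / _ => ?; lra.
Qed.

(** * Polynomials on the unit circle *)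

(** The relation b^2 = 1 - a^2 reduces a polynomial in (a, b) to degree one in
    b.  The degree of B is one less than that of A so that this class is
    closed under products with degrees adding up. *)
Definition circle_poly (F : nzRingType) (m : nat) (f : F -> F -> F) : Prop :=
  exists A B : {poly F}, [/\ (size A <= m.+1)%N, (size B <= m)%N &
    forall a b, a ^+ 2 + b ^+ 2 = 1 -> f a b = A.[a] + b * B.[a]].

Lemma circle_poly_cst (F : nzRingType) (c : F) : circle_poly 0 (fun _ _ => c).
Proof.
exists c%:P, 0; split=> [||a b _]; rewrite ?size_poly0 ?size_polyC_leq1 //.
by rewrite hornerC horner0 mulr0 addr0.
Qed.

Lemma circle_poly_linear (F : comNzRingType) (u v : F) :
  circle_poly 1 (fun a b => a * u + b * v).
Proof.
exists (u *: 'X), v%:P; split=> [||a b _]; rewrite ?size_polyC_leq1 //.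
  by apply: leq_trans (size_scale_leq _ _) _; rewrite size_polyX.
by rewrite hornerZ hornerX hornerC mulrC.
Qed.

Lemma circle_poly_leq (F : nzRingType) (m m' : nat) (f : F -> F -> F) :
  (m <= m')%N -> circle_poly m f -> circle_poly m' f.
Proof.
move=> mm' [A [B [sA sB fE]]]; exists A, B.
by split=> //; [exact: leq_trans sA _ | exact: leq_trans sB mm'].
Qed.

Lemma circle_polyD (F : nzRingType) (m : nat) (f g : F -> F -> F) :
  circle_poly m f -> circle_poly m g -> circle_poly m (fun a b => f a b + g a b).
Proof.
move=> [A [B [sA sB fE]]] [A' [B' [sA' sB' gE]]]; exists (A + A'), (B + B').
split=> [||a b ab].
- by apply: leq_trans (size_polyD _ _) _; rewrite geq_max sA.
- by apply: leq_trans (size_polyD _ _) _; rewrite geq_max sB.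
by rewrite fE // gE // !hornerD mulrDr addrACA.
Qed.

Lemma circle_polyM (F : comNzRingType) (m m' : nat) (f g : F -> F -> F) :
  circle_poly m f -> circle_poly m' g ->
  circle_poly (m + m') (fun a b => f a b * g a b).
Proof.
move=> [A [B [sA sB fE]]] [A' [B' [sA' sB' gE]]].
have sM (p q : {poly F}) k l : (size p <= k)%N -> (size q <= l)%N ->
    (size (p * q)%R <= (k + l).-1)%N.
  move=> sp sq; apply: leq_trans (size_polyMleq _ _) _.
  by rewrite -!subn1 leq_sub2r // leq_add.
have sBB : (size ((B * B') * (1 - 'X^2))%R <= (m + m').+1)%N.
  have sp := sM _ _ _ _ sB sB'; have [->|p0] := eqVneq (B * B') 0.
    by rewrite mul0r size_poly0.
  have s2 : (size (1 - 'X^2 : {poly F})%R <= 3)%N.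
    by rewrite -opprB size_polyN -polyC1 size_XnsubC.
  apply: leq_trans (sM _ _ _ _ sp s2) _.
  have : (0 < (m + m').-1)%N by rewrite (leq_trans _ sp) // size_poly_gt0.
  lia.
exists (A * A' + (B * B') * (1 - 'X^2)), (A * B' + B * A'); split=> [||a b ab].
- apply: leq_trans (size_polyD _ _) _; rewrite geq_max sBB andbT.
  by apply: leq_trans (sM _ _ _ _ sA sA') _; lia.
- apply: leq_trans (size_polyD _ _) _; rewrite geq_max.
  apply/andP; split; first by apply: leq_trans (sM _ _ _ _ sA sB') _.
  by apply: leq_trans (sM _ _ _ _ sB sA') _; lia.
rewrite fE // gE // !hornerE.
transitivity (A.[a] * A'.[a] + b ^+ 2 * (B.[a] * B'.[a]) +
  b * (A.[a] * B'.[a] + B.[a] * A'.[a])); first by ring.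
by have -> : b ^+ 2 = 1 - a ^+ 2; [rewrite -ab addrAC subrr add0r | ring].
Qed.

Lemma circle_poly_prod (F : comNzRingType) (I : Type) (r : seq I) (e : I -> nat)
    (f : I -> F -> F -> F) :
  (forall i, circle_poly (e i) (f i)) ->
  circle_poly (\sum_(i <- r) e i) (fun a b => \prod_(i <- r) f i a b).
Proof.
move=> fe; elim: r => [|i r IH].
  have [A [B [sA sB fE]]] := circle_poly_cst (1 : F).
  exists A, B; split=> [||a b ab]; rewrite ?big_nil //; exact: fE.
have [A [B [sA sB fE]]] := circle_polyM (fe i) IH.
exists A, B; split=> [||a b ab]; rewrite ?big_cons //; exact: fE.
Qed.

Lemma circle_polyX (F : comNzRingType) (m k : nat) (f : F -> F -> F) :
  circle_poly m f -> circle_poly (m * k) (fun a b => f a b ^+ k).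
Proof.
move=> fm; elim: k => [|k IH]; first by rewrite muln0; exact: circle_poly_cst.
have [A [B [sA sB fE]]] := circle_polyM fm IH.
by exists A, B; split=> [||a b ab]; rewrite ?mulnS // exprS fE.
Qed.

Lemma circle_poly_sum (F : nzRingType) (I : eqType) (r : seq I) (m : nat)
    (f : I -> F -> F -> F) :
  (forall i, i \in r -> circle_poly m (f i)) ->
  circle_poly m (fun a b => \sum_(i <- r) f i a b).
Proof.
elim: r => [|i r IH] fm.
  have [A [B [sA sB fE]]] := circle_poly_leq (leq0n m) (circle_poly_cst (0 : F)).
  exists A, B; split=> [||a b ab]; rewrite ?big_nil //; exact: fE.
have [||A [B [sA sB fE]]] := @circle_polyD _ m (f i) _ _ (IH _).
- by apply: fm; rewrite mem_head.
- by move=> j jr; apply: fm; rewrite inE jr orbT.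
exists A, B; split=> [||a b ab]; rewrite ?big_cons //; exact: fE.
Qed.

Lemma circle_poly_meval (F : comNzRingType) (d n : nat) (P : mpoly d F)
    (u v : 'I_d -> F) :
  (mpoly.msize P <= n.+1)%N ->
  circle_poly n (fun a b => meval (fun i => a * u i + b * v i) P).
Proof.
move=> sP.
have terms m : m \in msupp P -> circle_poly n (fun a b =>
    mcoeff m P * \prod_i (a * u i + b * v i) ^+ m i).
  move=> mP; have degm : (mdeg m <= n)%N.
    by rewrite -ltnS (leq_trans (msize_mdeg_lt mP)).
  apply: circle_poly_leq degm _; rewrite mdegE -[(\sum_i _)%N]add0n.
  apply: circle_polyM (circle_poly_cst _) _.
  apply: circle_poly_prod => i.
  by have := circle_polyX (m i) (circle_poly_linear (u i) (v i)); rewrite mul1n.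
have [A [B [sA sB fE]]] := circle_poly_sum terms.
by exists A, B; split=> // a b ab; rewrite mevalE fE.
Qed.

(** The even part A has A(1) = f(1, 0), and A(a) = f(a, -b) / 2 when f
    vanishes at (a, b); so |A| loses at least half of its maximum between 1
    and a, which the endpoint inequality allows only if 1 - a is at least of
    order 1 / m^2. *)
Lemma circle_poly_zero_far (F : rcfType) (m : nat) (f : F -> F -> F) (a b : F) :
  circle_poly m f ->
  (forall s t, s ^+ 2 + t ^+ 2 = 1 -> `|f s t| <= `|f 1 0|) ->
  f 1 0 != 0 -> a ^+ 2 + b ^+ 2 = 1 -> f a b = 0 ->
  1 <= 8 * m%:R ^+ 2 * (1 - a).
Proof.
move=> [A [B [sA sB fE]]] fmax f0 ab fab.
have f10 : f 1 0 = A.[1] by rewrite fE ?mul0r ?addr0 // expr1n expr0n addr0.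
have even s t : s ^+ 2 + t ^+ 2 = 1 -> f s t + f s (- t) = 2 * A.[s].
  by move=> st; rewrite !fE ?sqrrN //; ring.
have Amax s : -1 <= s <= 1 -> `|A.[s]| <= `|A.[1]|.
  move=> /andP[s1 s2]; pose t := Num.sqrt (1 - s ^+ 2).
  have st : s ^+ 2 + t ^+ 2 = 1 by rewrite sqr_sqrtr; [ring | nra].
  have := fmax s t st; have := fmax s (- t); rewrite sqrrN => /(_ st).
  have := ler_normD (f s t) (f s (- t)).
  by rewrite even // normrM f10 ger0_norm //; lra.
have aint : -1 <= a <= 1 by apply/andP; split; nra.
have half : `|A.[a]| <= `|A.[1]| / 2.
  have := even a b ab; rewrite fab add0r => e.
  have := fmax a (- b); rewrite sqrrN => /(_ ab).
  by rewrite e normrM f10 ger0_norm //; lra.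
have := markov_endpoint sA Amax aint.
have pos : 0 < `|A.[1]| by rewrite normr_gt0 -f10.
have := ler_normD (A.[1] - A.[a]) A.[a]; rewrite subrK => h1 h2.
rewrite -(ler_pM2r pos) mul1r.
have -> : 8 * m%:R ^+ 2 * (1 - a) * `|A.[1]| =
          2 * (4 * m%:R ^+ 2 * (1 - a) * `|A.[1]|) by ring.
by lra.
Qed.

(** * Points where a polynomial does not vanish *)

Lemma exists_nonroot (F : numFieldType) (p : {poly F}) :
  p != 0 -> exists t, p.[t] != 0.
Proof.
move=> p0; pose rs : seq F := [seq k%:R | k <- iota 0 (size p)].
have /allPn[t _ tp] : ~~ all (root p) rs.
  apply: contraL (leqnn (size p)) => roots; rewrite -ltnNge.
  rewrite -[X in (X < _)%N](size_iota 0) -(size_map (fun k => k%:R : F)).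
  apply: max_poly_roots => //; rewrite map_inj_uniq ?iota_uniq //.
  by move=> i j /eqP; rewrite eqr_nat => /eqP.
by exists t.
Qed.

Lemma base_digits_inj (d k : nat) (m m' : 'I_d -> nat) :
  (forall i, m i < k)%N -> (forall i, m' i < k)%N ->
  (\sum_i m i * k ^ i = \sum_i m' i * k ^ i)%N -> m =1 m'.
Proof.
elim: d m m' => [|d IH] m m' mk mk' e; first by case.
have split_low (f : 'I_d.+1 -> nat) : (\sum_i f i * k ^ i =
    (\sum_(i < d) f (lift ord0 i) * k ^ i) * k + f ord0)%N.
  rewrite big_ord_recl expn0 muln1 addnC big_distrl; congr (_ + _)%N.
  by apply: eq_bigr => i _; rewrite /= /bump leq0n add1n expnS mulnCA mulnC.
move: e; rewrite !split_low => e.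
have e0 : m ord0 = m' ord0.
  by have := congr1 (modn^~ k) e; rewrite !modnMDl !modn_small.
have k0 : (0 < k)%N by apply: leq_ltn_trans (mk ord0).
move: e; rewrite e0 => /addIn/eqP; rewrite eqn_pmul2r // => /eqP e i.
case: (unliftP ord0 i) => [j ->|-> //].
exact: (IH (fun j => m (lift ord0 j)) (fun j => m' (lift ord0 j))).
Qed.

(** Kronecker substitution: putting t^(k^i) for the i-th variable, with k
    larger than every exponent, sends distinct monomials to distinct powers of
    t, so it produces a nonzero polynomial in t. *)
Lemma exists_meval_neq0 (F : numFieldType) (d : nat) (P : mpoly d F) :
  P != 0 -> exists v : 'I_d -> F, meval v P != 0.
Proof.
move=> P0; set k := mpoly.msize P.
have [m0 m0P] : exists m, m \in msupp P.
  case E : (msupp P) => [|m s]; last by exists m; rewrite mem_head.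
  by move/eqP: E; rewrite msupp_eq0 (negPf P0).
pose code (m : multinom d) := (\sum_i m i * k ^ i)%N.
pose g : {poly F} := \sum_(m <- msupp P) mcoeff m P *: 'X^(code m).
have gE t : g.[t] = meval (fun i => t ^+ (k ^ i)) P.
  rewrite horner_sum mevalE; apply: eq_bigr => m _.
  rewrite hornerZ hornerXn; congr (_ * _); rewrite /code.
  rewrite expr_sum; apply: eq_bigr => i _.
  by rewrite -exprM mulnC.
have code_inj : {in msupp P &, injective code}.
  move=> m m' mP m'P e; apply/mnmP; apply: base_digits_inj e.
    move=> i; apply: leq_ltn_trans (msize_mdeg_lt mP).
    by rewrite mdegE (bigD1 i) //= leq_addr.
  move=> i; apply: leq_ltn_trans (msize_mdeg_lt m'P).
  by rewrite mdegE (bigD1 i) //= leq_addr.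
have g0 : g != 0.
  apply/eqP => /(congr1 (fun p : {poly F} => p`_(code m0))).
  rewrite coef0 coef_sum (bigD1_seq m0) ?msupp_uniq //= coefZ coefXn eqxx mulr1.
  rewrite big_seq_cond big1 => [/eqP|m /andP[mP mm0]].
    by rewrite addr0 mcoeff_eq0 m0P.
  rewrite coefZ coefXn; case: eqP => [/code_inj|]; last by rewrite mulr0.
  by move=> /(_ m0P mP) e; rewrite e eqxx in mm0.
have [t] := exists_nonroot g0; rewrite gE => tP.
by exists (fun i => t ^+ (k ^ i)).
Qed.

(** Counting: among 2 deg g + 2 points of the circle with distinct first and
    distinct second coordinates, at most deg g are lost to each coordinate. *)
Lemma exists_circle_nonroot (F : rcfType) (g : {poly F}) :
  g != 0 -> exists a b, [/\ a ^+ 2 + b ^+ 2 = 1, g.[a] != 0 & g.[b] != 0].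
Proof.
move=> g0; pose N := (size g + size g)%N.
pose a (k : nat) : F := k.+1%:R^-1; pose b k := Num.sqrt (1 - a k ^+ 2).
have ab k : a k ^+ 2 + b k ^+ 2 = 1.
  rewrite sqr_sqrtr; first by rewrite addrC subrK.
  have a1 : a k <= 1 by rewrite invf_le1 ?ler1n ?ltr0n.
  have a0 : 0 <= a k by rewrite invr_ge0.
  nra.
have a_inj : injective a.
  by move=> i j /invr_inj /eqP; rewrite eqr_nat eqSS => /eqP.
have b_inj : injective b.
  move=> i j bij; apply: a_inj; apply/eqP.
  rewrite -(@eqrXn2 _ 2) ?invr_ge0 //; apply/eqP.
  by have := ab i; rewrite bij -(ab j) => /addIr.
have few (c : nat -> F) (s : seq nat) : injective c -> uniq s ->
    all (fun k => root g (c k)) s -> (size s < size g)%N.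
  move=> c_inj us sr; rewrite -(size_map c); apply: max_poly_roots => //.
    by rewrite all_map.
  by rewrite map_inj_uniq.
have [/allP all_bad|/allPn[k _]] :=
    boolP (all (fun k => root g (a k) || root g (b k)) (iota 0 N)); last first.
  by rewrite negb_or => /andP[ga gb]; exists (a k), (b k).
pose s := filter (fun k => root g (a k)) (iota 0 N).
pose s' := filter (predC (fun k => root g (a k))) (iota 0 N).
have := few a s a_inj; rewrite filter_uniq ?iota_uniq // filter_all.
move=> /(_ isT isT) l.
have := few b s' b_inj; rewrite filter_uniq ?iota_uniq // => /(_ isT) l'.
have /l' : all (fun k => root g (b k)) s'.
  apply/allP => k; rewrite mem_filter /= => /andP[/negPf na /all_bad].
  by rewrite na.
have : (size s + size s' = N)%N.
  by rewrite !size_filter count_predC size_iota.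
by move: l; rewrite /N; lia.
Qed.

(** * Euclidean geometry of pairs *)

Definition dot (F : pzRingType) (d : nat) (x y : 'rV[F]_d) : F :=
  \sum_(i < d) x ord0 i * y ord0 i.

Lemma dotC (F : comPzRingType) (d : nat) (x y : 'rV[F]_d) : dot x y = dot y x.
Proof. by apply: eq_bigr => i _; rewrite mulrC. Qed.

Lemma dotDl (F : pzRingType) (d : nat) (x y z : 'rV[F]_d) :
  dot (x + y) z = dot x z + dot y z.
Proof. by rewrite -big_split; apply: eq_bigr => i _; rewrite mxE mulrDl. Qed.

Lemma dotZl (F : pzRingType) (d : nat) (c : F) (x z : 'rV[F]_d) :
  dot (c *: x) z = c * dot x z.
Proof. by rewrite mulr_sumr; apply: eq_bigr => i _; rewrite mxE mulrA. Qed.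

Lemma dotNl (F : pzRingType) (d : nat) (x z : 'rV[F]_d) : dot (- x) z = - dot x z.
Proof. by rewrite -scaleN1r dotZl mulN1r. Qed.

Definition dotE := (dotDl, dotZl, dotNl).

Lemma dot_ge0 (F : realDomainType) (d : nat) (x : 'rV[F]_d) : 0 <= dot x x.
Proof. by apply: sumr_ge0 => i _; rewrite -expr2 sqr_ge0. Qed.

Lemma dot_eq0 (F : realDomainType) (d : nat) (x : 'rV[F]_d) : dot x x = 0 -> x = 0.
Proof.
move=> x0; apply/rowP => i; rewrite mxE; apply/eqP; rewrite -sqrf_eq0 expr2.
have /psumr_eq0P -> // : dot x x = 0 by [].
by move=> j _; rewrite -expr2 sqr_ge0.
Qed.

Lemma enorm_sqr (R : realType) (d : nat) (x : 'rV[R]_d) : enorm x ^+ 2 = dot x x.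
Proof.
rewrite sqr_sqrtr; last by apply: sumr_ge0 => i _; rewrite sqr_ge0.
by apply: eq_bigr => i _; rewrite expr2.
Qed.

(** Expand |(y.y) x - (x.y) y|^2 >= 0 and divide by y.y. *)
Lemma cauchy_schwarz (F : realFieldType) (d : nat) (x y : 'rV[F]_d) :
  dot x y ^+ 2 <= dot x x * dot y y.
Proof.
have [/dot_eq0 ->|y0] := eqVneq (dot y y) 0.
  by rewrite dotC -[0](scale0r (0 : 'rV_d)) !dotZl !mul0r mulr0 expr0n.
have pos : 0 < dot y y by rewrite lt_def y0 dot_ge0.
have := dot_ge0 (dot y y *: x - dot x y *: y).
rewrite !(dotE, dotC _ (_ + _)) (dotC y x).
set a := dot x x; set b := dot x y; set c := dot y y => h.
have : 0 <= c * (a * c - b ^+ 2) by move: h; lra.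
by rewrite pmulr_rge0 // subr_ge0.
Qed.

Lemma pair_sphereE (R : realType) (d : nat) (x y : 'rV[R]_d) :
  pair_sphere (x, y) <-> dot x x + dot y y = 1.
Proof. by rewrite /pair_sphere /= !enorm_sqr. Qed.

(** * The maximizer on the sphere of pairs *)

Lemma exists_unit_line_neq0 (F : rcfType) (d : nat) (P : mpoly d F) :
  (0 < d)%N -> P != 0 ->
  exists w : 'rV[F]_d, dot w w = 1 /\ exists t, meval ((t *: w) ord0) P != 0.
Proof.
move=> d0 /exists_meval_neq0[v vP]; pose x : 'rV[F]_d := \row_i v i.
have xP : meval (x ord0) P != 0.
  by rewrite (@meval_eq _ _ _ v) // => i; rewrite mxE.
have [x0|x0] := eqVneq (dot x x) 0.
  exists (delta_mx ord0 (Ordinal d0)); split.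
    rewrite /dot (bigD1 (Ordinal d0)) //= big1 => [|i i0].
      by rewrite !mxE !eqxx mulr1 addr0.
    by rewrite !mxE (negPf i0) andbF mul0r.
  by exists 0; rewrite scale0r -(dot_eq0 x0).
have pos : 0 < dot x x by rewrite lt_def x0 dot_ge0.
have s0 : Num.sqrt (dot x x) != 0 by rewrite gt_eqF // sqrtr_gt0.
exists ((Num.sqrt (dot x x))^-1 *: x); split; last first.
  by exists (Num.sqrt (dot x x)); rewrite scalerA divff // scale1r.
rewrite dotZl (dotC x (_ *: _)) dotZl mulrA -expr2 exprVn sqr_sqrtr ?(ltW pos) //.
by rewrite mulVf.
Qed.

(** This makes the maximum of |P(x) P(y)| positive.  A nonzero P may vanish on
    a whole sphere, so the two radii have to be chosen: on a suitable line
    through the origin only finitely many of them are excluded. *)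
Lemma exists_pair_sphere_neq0 (R : realType) (d : nat) (P : mpoly d R) :
  (0 < d)%N -> P != 0 ->
  exists z, pair_sphere z /\ peval P z.1 * peval P z.2 != 0.
Proof.
move=> d0 P0; have [w [w1 [t tP]]] := exists_unit_line_neq0 d0 P0.
pose g : {poly R} :=
  \sum_(m <- msupp P) (mcoeff m P)%:P * \prod_i (w ord0 i *: 'X) ^+ m i.
have gE s : g.[s] = peval P (s *: w).
  rewrite horner_sum /peval mevalE; apply: eq_bigr => m _.
  rewrite hornerM hornerC horner_prod; congr (_ * _); apply: eq_bigr => i _.
  by rewrite horner_exp hornerZ hornerX mxE mulrC.
have [|a [b [ab ga gb]]] := @exists_circle_nonroot _ g.
  by apply: contraNneq tP => g0; move: (gE t); rewrite g0 horner0 /peval => <-.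
exists (a *: w, b *: w); split; last by rewrite mulf_neq0 // -gE.
by apply/pair_sphereE; rewrite !dotE !(dotC w) !dotE w1 !mulr1 -!expr2.
Qed.

(** The great circle through u = (p, q) and w = (z, y) is spanned by u and
    the unit vector v = (w - a u) / b, where a is the inner product of u and w
    and b = sqrt(1 - a^2).  Restricting P(x) P(y) to it gives a function of
    degree 2 n with maximal modulus at (1, 0) and a zero at (a, b), and
    |u - w|^2 = 2 (1 - a). *)
Lemma maximizer_zero_far (R : realType) (d n : nat) (P : mpoly d R)
    (p q z y : 'rV[R]_d) :
  (0 < n)%N -> (mpoly.msize P <= n.+1)%N ->
  maximizes (fun z : 'rV[R]_d * 'rV[R]_d => `|peval P z.1 * peval P z.2|)
    (@pair_sphere R d) (p, q) ->
  peval P p * peval P q != 0 ->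
  pair_sphere (z, y) -> peval P z * peval P y = 0 ->
  1 <= 16 * n%:R ^+ 2 * (dot (p - z) (p - z) + dot (q - y) (q - y)).
Proof.
move=> n0 sP [/pair_sphereE pq max] nz zy_on zero; have /pair_sphereE zy := zy_on.
set a := dot p z + dot q y.
have distE : dot (p - z) (p - z) + dot (q - y) (q - y) = 2 * (1 - a).
  transitivity (dot p p + dot q q + (dot z z + dot y y) - 2 * a).
    by rewrite /a !(dotE, dotC _ (_ - _)) (dotC z p) (dotC y q); ring.
  by rewrite pq zy; ring.
rewrite distE; set b := Num.sqrt (1 - a ^+ 2).
pose vz := z - a *: p; pose vy := y - a *: q.
have vv : dot vz vz + dot vy vy = 1 - a ^+ 2.
  transitivity (dot z z + dot y y - 2 * a * a + a ^+ 2 * (dot p p + dot q q)).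
    by rewrite /vz /vy !(dotE, dotC _ (_ - _)) (dotC z p) (dotC y q) /a; ring.
  by rewrite zy pq; ring.
have b2 : b ^+ 2 = 1 - a ^+ 2 by rewrite sqr_sqrtr // -vv addr_ge0 ?dot_ge0.
(* When w is collinear with u there is no v; then w = u is excluded by the
   values of the product, and w = - u is far away. *)
have [b0|b0] := eqVneq b 0.
  have [vz0 vy0] : vz = 0 /\ vy = 0.
    move: vv; rewrite -b2 b0 expr0n /= => v0.
    by split; apply: dot_eq0; have := dot_ge0 vz; have := dot_ge0 vy; lra.
  have zE : z = a *: p by rewrite -(subrK (a *: p) z) -/vz vz0 add0r.
  have yE : y = a *: q by rewrite -(subrK (a *: q) y) -/vy vy0 add0r.
  have /eqP : a ^+ 2 = 1 by move: b2; rewrite b0 expr0n /=; lra.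
  rewrite sqrf_eq1 => /orP[/eqP a1|/eqP a1].
    by move: nz; rewrite -zero zE yE a1 !scale1r eqxx.
  have : 1 <= n%:R ^+ 2 :> R by rewrite -natrX ler1n expn_gt0 n0.
  by rewrite a1; lra.
pose f s t := peval P (s *: p + t *: (b^-1 *: vz)) *
              peval P (s *: q + t *: (b^-1 *: vy)).
have f_poly : circle_poly (n + n) f.
  have [A [B [sA sB fE]]] := circle_polyM
    (circle_poly_meval (p ord0) ((b^-1 *: vz) ord0) sP)
    (circle_poly_meval (q ord0) ((b^-1 *: vy) ord0) sP).
  exists A, B; split=> // s t st; rewrite -fE // /f /peval.
  by congr (_ * _); apply: meval_eq => i; rewrite !mxE.
have f10 : f 1 0 = peval P p * peval P q.
  by rewrite /f !scale1r !scale0r !addr0.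
have fab : f a b = 0.
  by rewrite /f !scalerA divff // !scale1r !subrKC.
have uv : dot p vz + dot q vy = 0.
  transitivity (a - a * (dot p p + dot q q)).
    by rewrite /vz /vy !(dotE, dotC _ (_ - _)) (dotC z p) (dotC y q) /a; ring.
  by rewrite pq mulr1 subrr.
have f_max s t : s ^+ 2 + t ^+ 2 = 1 -> `|f s t| <= `|f 1 0|.
  move=> st; rewrite f10.
  apply: (max (s *: p + t *: (b^-1 *: vz), s *: q + t *: (b^-1 *: vy))).
  apply/pair_sphereE; rewrite !scalerA.
  transitivity (s ^+ 2 * (dot p p + dot q q) +
    2 * s * (t / b) * (dot p vz + dot q vy) +
    (t / b) ^+ 2 * (dot vz vz + dot vy vy)).
    set k := t / b; rewrite !(dotE, dotC _ (_ + _), dotC _ (_ *: _)).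
    by rewrite (dotC z p) (dotC y q); ring.
  by rewrite pq uv vv -b2 -exprMn divfK // mulr1 mulr0 addr0.
have := circle_poly_zero_far f_poly f_max; rewrite f10 => /(_ a b nz).
rewrite b2 addrC subrK => /(_ erefl fab); rewrite addnn -mul2n natrM; lra.
Qed.

(** The point is y = s q with s^2 |q|^2 = 1 - |z|^2.  Then
    (1 - s)^2 (1 + s)^2 |q|^4 = (|z|^2 - |p|^2)^2, which is at most
    |z - p|^2 |z + p|^2 by Cauchy-Schwarz.  Here |z + p|^2 <= 3 and
    (1 + s)^2 |q|^2 >= 1/2, so |q - y|^2 = (1 - s)^2 |q|^2 is at most
    6 |z - p|^2. *)
Lemma sphere_completion (R : realType) (d : nat) (p q z : 'rV[R]_d) :
  dot p p + dot q q = 1 -> dot p p <= dot q q ->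
  dot (p - z) (p - z) <= 20^-1 ->
  exists y, pair_sphere (z, y) /\
    dot (q - y) (q - y) <= 6 * dot (p - z) (p - z).
Proof.
move=> pq le; set D := dot (p - z) (p - z) => D_small.
have D0 : 0 <= D by apply: dot_ge0.
have DE : D = dot p p - 2 * dot p z + dot z z.
  by rewrite /D !(dotE, dotC _ (_ - _)) (dotC z p); ring.
have z_small : dot z z <= 9 / 10.
  (* Nonnegativity of |3 p - 2 z|^2 says |z|^2 <= 3/2 |p|^2 + 3 D. *)
  have := dot_ge0 (3 *: p - 2 *: z).
  rewrite !(dotE, dotC _ (_ - _), dotC _ (_ *: _)) (dotC z p); lra.
have sum_small : dot (p + z) (p + z) <= 3.
  rewrite !(dotE, dotC _ (_ + _)) (dotC z p); lra.
have diff_small : (dot z z - dot p p) ^+ 2 <= 3 * D.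
  have -> : (dot z z - dot p p) ^+ 2 = dot (p - z) (p + z) ^+ 2.
    by rewrite !(dotE, dotC _ (_ + _)) (dotC z p); ring.
  apply: le_trans (cauchy_schwarz _ _) _; rewrite -/D; nra.
have Q_half : 1 / 2 <= dot q q by lra.
set Q := dot q q in pq le Q_half.
pose s := Num.sqrt ((1 - dot z z) / Q).
have s0 : 0 <= s by apply: sqrtr_ge0.
have sQ : s ^+ 2 * Q = 1 - dot z z.
  rewrite sqr_sqrtr; first by rewrite divfK // gt_eqF //; lra.
  by rewrite divr_ge0; lra.
exists (s *: q); split.
  apply/pair_sphereE; rewrite dotZl (dotC q (_ *: _)) dotZl -/Q.
  by move: sQ; lra.
have -> : dot (q - s *: q) (q - s *: q) = (1 - s) ^+ 2 * Q.
  by rewrite !(dotE, dotC _ (_ - _), dotC _ (_ *: _)) -/Q; ring.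
have key : ((1 - s) ^+ 2 * Q) * ((1 + s) ^+ 2 * Q) <= 3 * D.
  have -> : ((1 - s) ^+ 2 * Q) * ((1 + s) ^+ 2 * Q) = (Q - s ^+ 2 * Q) ^+ 2 by ring.
  by rewrite sQ; have -> : Q - (1 - dot z z) = dot z z - dot p p by lra.
have : (1 - s) ^+ 2 * Q * (1 / 2) <= (1 - s) ^+ 2 * Q * ((1 + s) ^+ 2 * Q).
  apply: ler_wpM2l; first by rewrite mulr_ge0 ?sqr_ge0 //; lra.
  nra.
lra.
Qed.

(** For z nearer than 1 / (20 n) to p the pair (z, y) would be at squared
    distance at most 7 / (400 n^2) from (p, q), below the 1 / (16 n^2) that
    separates (p, q) from the zeros of the product. *)
Lemma smaller_point_zero_far (R : realType) (d n : nat) (P : mpoly d R)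
    (p q : 'rV[R]_d) :
  (0 < d)%N -> (0 < n)%N -> P != 0 -> (mpoly.msize P <= n.+1)%N ->
  maximizes (fun z : 'rV[R]_d * 'rV[R]_d => `|peval P z.1 * peval P z.2|)
    (@pair_sphere R d) (p, q) ->
  dot p p <= dot q q ->
  dist_at_least (20^-1 / n%:R) p (zero_set P).
Proof.
move=> d0 n0 P0 sP max le z Pz; rewrite leNgt; apply/negP => close.
have [/pair_sphereE pq _] := max.
have n1 : 1 <= n%:R :> R by rewrite ler1n.
set D := dot (p - z) (p - z).
have Dn : 400 * n%:R ^+ 2 * D <= 1.
  have : enorm (p - z) * n%:R <= 20^-1.
    by rewrite -ler_pdivlMr ?ltr0n // ltW.
  have : 0 <= enorm (p - z) * n%:R by rewrite mulr_ge0 ?sqrtr_ge0 ?ler0n.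
  rewrite /D -enorm_sqr; nra.
have D0 : 0 <= D by apply: dot_ge0.
have [|y [zy qy]] := sphere_completion pq le (z := z).
  by rewrite -/D; nra.
have nz : peval P p * peval P q != 0.
  have [w [w_on wP]] := exists_pair_sphere_neq0 d0 P0.
  by rewrite -normr_gt0 (lt_le_trans _ (max.2 _ w_on)) // normr_gt0.
have := maximizer_zero_far n0 sP max nz zy.
rewrite [peval P z]Pz mul0r => /(_ erefl); rewrite -/D in qy *.
nra.
Qed.

Theorem theorem1p4 (R : realType) :
  exists C : R, 0 < C /\
    forall (d n : nat) (P : mpoly d R) (p q : 'rV[R]_d),
      (1 <= d)%N -> (1 <= n)%N ->
      P != 0 -> mpoly.msize P = n.+1 ->
      maximizes
        (fun z : 'rV[R]_d * 'rV[R]_d => `|peval P z.1 * peval P z.2|)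
        (@pair_sphere R d) (p, q) ->
      [/\ unit_ball p, unit_ball q
        & dist_at_least (C / n%:R) p (zero_set P) \/
          dist_at_least (C / n%:R) q (zero_set P)].
Proof.
exists 20^-1; split; first by rewrite invr_gt0.
move=> d n P p q d0 n0 P0 sP max; have [/pair_sphereE pq bound] := max.
have ball (x : 'rV[R]_d) : dot x x <= 1 -> unit_ball x.
  move=> x1; rewrite /unit_ball /= -(@ler_pXn2r _ 2) ?nnegrE ?sqrtr_ge0 //.
  by rewrite enorm_sqr expr1n.
have p0 := dot_ge0 p; have q0 := dot_ge0 q.
split; [by apply: ball; lra|by apply: ball; lra|].
have [le|/ltW le] := leP (dot p p) (dot q q).
  by left; apply: smaller_point_zero_far le; rewrite ?sP.
right; apply: smaller_point_zero_far le; rewrite ?sP //.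
split=> [|[x y] /pair_sphereE xy]; first by apply/pair_sphereE; rewrite addrC.
rewrite /= [X in `|X| <= _]mulrC [X in _ <= `|X|]mulrC; apply: (bound (y, x)).
by apply/pair_sphereE; rewrite addrC.
Qed.
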